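(* Let $A$ be a real constant $n\times n$ matrix and $B=A^{T}$. Suppose $\nu=\overset{*}{\nu}+\widetilde\nu\, i$ (with $\overset{*}{\nu}=\mathrm{Re}\,\nu$, $\widetilde\nu=\mathrm{Im}\,\nu$) is an eigenvector of $B$ corresponding to the eigenvalue $\lambda=\overset{*}{\lambda}+\widetilde\lambda\, i$ with $\overset{*}{\lambda}=\mathrm{Re}\,\lambda$, $\widetilde\lambda=\mathrm{Im}\,\lambda\neq0$. Then the system $\dfrac{dx}{dt}=Ax$ has the autonomous first integral $$F\colon x\mapsto \bigl((\overset{*}{\nu}x)^2+(\widetilde\nu x)^2\bigr)\exp\Bigl(-2\,\frac{\overset{*}{\lambda}}{\widetilde\lambda}\,\arctan\frac{\widetilde\nu x}{\overset{*}{\nu}x}\Bigr)\quad\text{for all }x\in\mathscr X,$$ where $\mathscr X$ is any domain contained in $\{x\in\mathbb R^n\colon \overset{*}{\nu}x\neq0\}$.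
   Context: A domain is an open arcwise connected set. For a vector $\nu=(\nu_1,\dots,\nu_n)$ and $x\in\mathbb R^n$, $\nu x=\sum_{\xi=1}^n\nu_\xi x_\xi$. An eigenvector $\nu$ of $B$ with eigenvalue $\lambda$ satisfies $B\nu=\lambda\nu$, $\nu\neq0$ regarded as a column. An autonomous first integral of $dx/dt=Ax$ on a domain $\mathscr X\subset\mathbb R^n$ is a continuously differentiable function $F\colon\mathscr X\to\mathbb R$ with $\sum_{\xi=1}^n (Ax)_\xi\,\partial_{x_\xi}F(x)=0$ for all $x\in\mathscr X$. *)

(* Defs.v *)
From HB Require Import structures.
From mathcomp Require Import all_boot all_order all_algebra.
From mathcomp Require Import all_classical all_reals all_analysis.
From mathcomp Require Import complex.

Set Implicit Arguments.
Unset Strict Implicit.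
Unset Printing Implicit Defensive.

Import Order.TTheory GRing.Theory Num.Theory.
Import numFieldNormedType.Exports.

Local Open Scope classical_set_scope.
Local Open Scope ring_scope.

Definition arcwise_connected (R : realType) (T : topologicalType) (X : set T) :=
  forall x y, X x -> X y ->
    exists g : R -> T, [/\ {within `[0, 1], continuous g},
      g 0 = x, g 1 = y & g @` `[0, 1] `<=` X].

Definition domain (R : realType) (n : nat) (X : set 'cV[R]_n) :=
  open X /\ arcwise_connected R X.

Definition dot (R : realType) (n : nat) (nu x : 'cV[R]_n) : R :=
  \sum_(k < n) nu k 0 * x k 0.

Definition Re_vec (R : realType) (n : nat) (nu : 'cV[R[i]]_n) : 'cV[R]_n :=
  map_mx (@complex.Re R) nu.

Definition Im_vec (R : realType) (n : nat) (nu : 'cV[R[i]]_n) : 'cV[R]_n :=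
  map_mx (@complex.Im R) nu.

(* [eigenvalue] and [eigenspace] of mxalgebra act on row vectors; here the
   eigenvectors are (complex) columns of a real matrix. *)
Definition eigenvector (R : realType) (n : nat) (B : 'M[R]_n)
    (lambda : R[i]) (nu : 'cV[R[i]]_n) :=
  map_mx (real_complex R) B *m nu = lambda *: nu /\ nu != 0.

Definition partial (R : realType) (n : nat) (k : 'I_n)
    (F : 'cV[R]_n -> R) : 'cV[R]_n -> R :=
  fun x => 'D_(delta_mx k 0) F x.

(* [F] is a total function, but for an open [X] this only depends on the
   restriction of [F] to [X]. *)
Definition continuously_differentiable (R : realType) (n : nat)
    (X : set 'cV[R]_n) (F : 'cV[R]_n -> R) :=
  forall k : 'I_n,
    (forall x, X x -> derivable F x (delta_mx k 0)) /\
    {within X, continuous (partial k F)}.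

Definition first_integral (R : realType) (n : nat) (A : 'M[R]_n)
    (X : set 'cV[R]_n) (F : 'cV[R]_n -> R) :=
  continuously_differentiable X F /\
  forall x, X x -> \sum_(k < n) (A *m x) k 0 * partial k F x = 0.

(* Main.v *)
(** The complex linear form [z = nu x] satisfies [dz/dt = lambda z] along the
    flow.  So [log |z|] grows at rate [Re lambda] and the argument of [z], which
    up to a locally constant multiple of [pi] is [atan (Im z / Re z)], at rate
    [Im lambda]; hence [2 log |z| - 2 (Re lambda / Im lambda) arg z] is constant,
    and [F] is its exponential. *)

Require Import Defs.
From HB Require Import structures.
From mathcomp Require Import all_boot all_order all_algebra.
From mathcomp Require Import all_classical all_reals all_analysis.
From mathcomp Require Import complex ring.

Set Implicit Arguments.
Unset Strict Implicit.
Unset Printing Implicit Defensive.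

Import Order.TTheory GRing.Theory Num.Theory.
Import numFieldNormedType.Exports.

Local Open Scope classical_set_scope.
Local Open Scope ring_scope.

(** Both difference quotients are the same function of [h]. This reduces directional derivatives to
    one-variable calculus. *)
Lemma is_derive_line (R : realType) (V : normedModType R) (f : V -> R)
    (x v : V) (d : R) :
  is_derive (0 : R) (1 : R) (fun h : R => f (h *: v + x)) d ->
  is_derive x v f d.
Proof.
have quotE : (fun h : R => h^-1 *: ((f \o shift x) (h *: v) - f x)) =
    (fun h : R => h^-1 *: (((fun h : R => f (h *: v + x)) \o shift 0)
      (h *: (1 : R)) - f ((0 : R) *: v + x))).
  by apply/funext => h /=; rewrite addr0 scale0r add0r [h *: 1]mulr1.
move=> [df dE]; split; first by rewrite /derivable quotE.
by rewrite -dE /derive quotE.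
Qed.

Section Dot.
Variables (R : realType) (n : nat).
Implicit Types (a b x v : 'cV[R]_n).

Lemma dotE a x : dot a x = (a^T *m x) 0 0.
Proof. by rewrite !mxE; apply: eq_bigr => k _; rewrite mxE. Qed.

Lemma dotDr a x y : dot a (x + y) = dot a x + dot a y.
Proof. by rewrite !dotE mulmxDr mxE. Qed.

Lemma dotZr a c x : dot a (c *: x) = c * dot a x.
Proof. by rewrite !dotE -scalemxAr mxE. Qed.

Lemma dotDl a b x : dot (a + b) x = dot a x + dot b x.
Proof. by rewrite !dotE linearD/= mulmxDl mxE. Qed.

Lemma dotZl c a x : dot (c *: a) x = c * dot a x.
Proof. by rewrite !dotE linearZ/= -scalemxAl mxE. Qed.

Lemma dot_mulmx (A : 'M[R]_n) a x : dot a (A *m x) = dot (A^T *m a) x.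
Proof. by rewrite !dotE trmx_mul trmxK mulmxA. Qed.

Lemma dot_delta a k : dot a (delta_mx k 0) = a k 0.
Proof.
rewrite /dot (bigD1 k)//= mxE !eqxx mulr1 big1 ?addr0// => j jk.
by rewrite mxE (negbTE jk) mulr0.
Qed.

Lemma dot_continuous a : continuous (dot a).
Proof.
move=> x; have add_cont := @add_continuous R^o.
have nbhsF : Filter (nbhs (x : 'cV[R]_n)) by exact: nbhs_filter.
apply: (cvg_big add_cont nbhsF) => k _.
by apply: cvgM; [exact: cvg_cst | exact: coord_continuous].
Qed.

End Dot.

(** The derivative of [atan (w / u)] is [(u dw - w du) / (u^2 + w^2)]; its denominator cancels
    against the factor in front of the exponential. *)
Lemma is_derive_spiral_curve (R : realType) (u w : R -> R) (c t du dw : R) :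
  u t != 0 -> is_derive t (1 : R) u du -> is_derive t (1 : R) w dw ->
  is_derive t (1 : R)
    (fun h => (u h ^+ 2 + w h ^+ 2) * expR (- 2 * c * atan (w h / u h)))
    (2 * (u t * du + w t * dw - c * (u t * dw - w t * du)) *
     expR (- 2 * c * atan (w t / u t))).
Proof.
move=> ut0 dut dwt.
have dquot := is_deriveM dwt (is_deriveV ut0 dut).
have datan := is_derive1_comp (is_derive1_atan _) dquot.
have dexp := is_derive1_comp (is_derive_expR _) (is_deriveZ (- 2 * c) datan).
have dsq := is_deriveD (is_deriveX 2 dut) (is_deriveX 2 dwt).
apply: (is_derive_eq (is_deriveM dsq dexp)).
set e := expR (_ * _ * atan _).
(* The derivative assembled by the rules, with scalings and operations on functions unfolded into
   field operations that [field] can read. *)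
change ((u t ^+ 2 + w t ^+ 2) * (e * (- 2 * c *
    ((1 + (w t / u t) ^+ 2)^-1 * (w t * (- u t ^- 2 * du) + (u t)^-1 * dw)))) +
  e * (2 * u t * du + 2 * w t * dw) =
  2 * (u t * du + w t * dw - c * (u t * dw - w t * du)) * e).
have n0 : u t ^+ 2 + w t ^+ 2 != 0.
  by rewrite gt_eqF// ltr_wpDr ?sqr_ge0// exprn_even_gt0.
have -> : 1 + (w t / u t) ^+ 2 = (u t ^+ 2 + w t ^+ 2) / u t ^+ 2 by field.
by field; rewrite ut0 n0.
Qed.

Section SpiralIntegral.
Variables (R : realType) (n : nat) (a b : 'cV[R]_n) (c : R).
Implicit Types x v : 'cV[R]_n.

(** In the half-planes of the coordinates [(dot a x, dot b x)] where the first is nonzero, the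
    positive level sets are arcs of logarithmic spirals [rho = C exp (c theta)]. *)
Definition spiral x :=
  (dot a x ^+ 2 + dot b x ^+ 2) * expR (- 2 * c * atan (dot b x / dot a x)).

(* The derivative of [spiral] at [x] in the direction [v]; the arctangent
   contributes [(p dq - q dp) / (p^2 + q^2)] for [p = dot a x], [q = dot b x]. *)
Definition dspiral x v :=
  2 * ((dot a x * dot a v + dot b x * dot b v) -
       c * (dot a x * dot b v - dot b x * dot a v)) *
  expR (- 2 * c * atan (dot b x / dot a x)).

Lemma is_derive_spiral x v :
  dot a x != 0 -> is_derive x v spiral (dspiral x v).
Proof.
move=> ax0; apply: is_derive_line.
(* Along the line, each linear form is affine in [h] with slope [dot w v]. *)
have line w : (fun h : R => dot w (h *: v + x)) =
      dot w v \*: (id : R -> R) + cst (dot w x).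
  by apply/funext => h; rewrite dotDr dotZr mulrC.
have dline w : is_derive (0 : R) (1 : R) (fun h : R => dot w (h *: v + x)) (dot w v).
  rewrite line; apply: is_derive_eq.
  by rewrite addr0 [_ *: _]mulr1.
have at0 w : dot w ((0 : R) *: v + x) = dot w x by rewrite scale0r add0r.
have aline0 : dot a ((0 : R) *: v + x) != 0 by rewrite at0.
rewrite /dspiral -(at0 a) -(at0 b); exact: is_derive_spiral_curve.
Qed.

Lemma spiral_continuously_differentiable (X : set 'cV[R]_n) :
  X `<=` [set x | dot a x != 0] -> continuously_differentiable X spiral.
Proof.
move=> Xa k; split=> [x /Xa ax0|].
  by have [] := is_derive_spiral (delta_mx k 0) ax0.
(* On [X] the partial derivative equals the explicit formula [dspiral], whose continuity at each
   point of [X] is then built up term by term. *)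
apply: (@subspace_eq_continuous _ _ _ (fun x => dspiral x (delta_mx k 0))).
  move=> x /set_mem/Xa ax0; rewrite /partial.
  exact: esym (derive_val (is_derive := is_derive_spiral (delta_mx k 0) ax0)).
apply: continuous_in_subspaceT => x /set_mem/Xa ax0.
have cM (f g : 'cV[R]_n -> R) : {for x, continuous f} -> {for x, continuous g} ->
  {for x, continuous (fun y => f y * g y)} by exact: continuousM.
have cD (f g : 'cV[R]_n -> R) : {for x, continuous f} -> {for x, continuous g} ->
  {for x, continuous (fun y => f y + g y)} by exact: continuousD.
have cN (f : 'cV[R]_n -> R) : {for x, continuous f} ->
  {for x, continuous (fun y => - f y)} by exact: continuousN.
have cC (r : R) : {for x, continuous (fun _ : 'cV[R]_n => r)} by exact: cst_continuous.
have cd w : {for x, continuous (dot w)} by exact: dot_continuous.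
have cdM w r : {for x, continuous (fun y => dot w y * r)}.
  exact: cM _ _ (cd w) (cC r).
have cdd := cM _ _ (cC 2) (cD _ _ (cD _ _ (cdM a _) (cdM b _))
  (cN _ (cM _ _ (cC c) (cD _ _ (cdM a _) (cN _ (cdM b _)))))).
have cquot : {for x, continuous (fun y => dot b y / dot a y)}.
  exact: cM _ _ (cd b) (continuousV ax0 (cd a)).
have catan := continuous_comp cquot (continuous_atan (x := _)).
have cexp := continuous_comp
  (cM _ _ (cC (- 2 * c)) catan) (continuous_expR (x := _)).
exact: cM _ _ (cdd _ _ _ _) cexp.
Qed.

(** [dspiral x] is linear in the direction, being a combination of [dot a] and [dot b] with
    coefficients [u] and [w] that depend only on [x]. *)
Lemma dspiral_sum x (y : 'cV[R]_n) :
  \sum_(k < n) y k 0 * dspiral x (delta_mx k 0) = dspiral x y.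
Proof.
pose e := expR (- 2 * c * atan (dot b x / dot a x)).
pose u := 2 * (dot a x + c * dot b x) * e.
pose w := 2 * (dot b x - c * dot a x) * e.
have dspiralE v : dspiral x v = u * dot a v + w * dot b v.
  by rewrite /dspiral -/e /u /w; ring.
rewrite dspiralE /dot !mulr_sumr -big_split/=; apply: eq_bigr => k _.
by rewrite dspiralE !dot_delta; ring.
Qed.

End SpiralIntegral.

(** The first two hypotheses are the real and imaginary parts of the eigenvector equation for
    [a + i b] and [r + i s]. The sum in question is the derivative of [spiral] in the direction
    [A *m x], and transposition moves [A] onto [a] and [b]. *)
Lemma spiral_first_integral (R : realType) (n : nat) (A : 'M[R]_n)
    (a b : 'cV[R]_n) (r s : R) (X : set 'cV[R]_n) :
  A^T *m a = r *: a - s *: b -> A^T *m b = s *: a + r *: b -> s != 0 ->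
  X `<=` [set x | dot a x != 0] ->
  first_integral A X (spiral a b (r / s)).
Proof.
move=> Aa Ab s0 Xa.
split=> [|x /Xa ax0]; first exact: spiral_continuously_differentiable.
rewrite (eq_bigr (fun k => (A *m x) k 0 * dspiral a b (r / s) x (delta_mx k 0))).
  rewrite dspiral_sum /dspiral !dot_mulmx Aa Ab.
  rewrite -scaleNr !dotDl !dotZl.
  (* With [u' = r u - s v] and [v' = s u + r v], one has [u u' + v v' = r (u^2 + v^2)] and
     [u v' - v u' = s (u^2 + v^2)]; the factor [r / s] makes them cancel. *)
  have zeroE u v e : 2 * (u * (r * u + - s * v) + v * (s * u + r * v) -
    r / s * (u * (s * u + r * v) - v * (r * u + - s * v))) * e = 0 :> R by field.
  exact: zeroE.
move=> k _; congr (_ * _).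
exact: (derive_val (is_derive := is_derive_spiral _ _ _ ax0)).
Qed.

(** Since [B] is real, multiplying by it commutes with taking real and imaginary parts; the
    right-hand sides are those of [lambda *: nu]. *)
Lemma eigenvector_Re_Im (R : realType) (n : nat) (B : 'M[R]_n)
    (lambda : R[i]) (nu : 'cV[R[i]]_n) :
  eigenvector B lambda nu ->
  B *m Re_vec nu =
    complex.Re lambda *: Re_vec nu - complex.Im lambda *: Im_vec nu /\
  B *m Im_vec nu =
    complex.Im lambda *: Re_vec nu + complex.Re lambda *: Im_vec nu.
Proof.
move=> [Bnu _].
have ReD : {morph @complex.Re R : z w / z + w} by case=> ? ? [].
have ImD : {morph @complex.Im R : z w / z + w} by case=> ? ? [].
have ReM z w : complex.Re (z * w) =
    complex.Re z * complex.Re w - complex.Im z * complex.Im w :> R.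
  by case: z w => [? ?] [? ?].
have ImM z w : complex.Im (z * w) =
    complex.Im z * complex.Re w + complex.Re z * complex.Im w :> R.
  by case: z w => [? ?] [? ?]; rewrite addrC.
split; apply/colP => k; move/colP/(_ k): Bnu; rewrite !mxE.
  move=> /(congr1 (@complex.Re R)).
  rewrite ReM (big_morph _ ReD (erefl _)) => <-.
  by apply: eq_bigr => j _; rewrite !mxE ReM/= mul0r subr0.
move=> /(congr1 (@complex.Im R)).
rewrite ImM (big_morph _ ImD (erefl _)) => <-.
by apply: eq_bigr => j _; rewrite !mxE ImM/= mul0r add0r.
Qed.

Theorem theorem1p2 (R : realType) (n : nat) (A B : 'M[R]_n)
    (nu : 'cV[R[i]]_n) (lambda : R[i]) (X : set 'cV[R]_n) :
  B = A^T ->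
  eigenvector B lambda nu ->
  complex.Im lambda != 0 ->
  domain X ->
  X `<=` [set x | dot (Re_vec nu) x != 0] ->
  first_integral A X (fun x =>
    ((dot (Re_vec nu) x) ^+ 2 + (dot (Im_vec nu) x) ^+ 2) *
    expR (- 2 * (complex.Re lambda / complex.Im lambda) *
          atan (dot (Im_vec nu) x / dot (Re_vec nu) x))).
Proof.
move=> -> /eigenvector_Re_Im[ARe AIm] lam0 _ Xa.
exact: spiral_first_integral ARe AIm lam0 Xa.
Qed.
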